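(* Let $\varphi$ be the unique continuous solution of the functional equation $$\varphi(x)=g_i\left(\varphi(Nx-i)\right),\qquad \tfrac{i}{N}\le x\le\tfrac{i+1}{N},\ i\in\Sigma_N,$$ and let $\mu_\varphi$ be the probability measure on $[0,1]$ whose distribution function is $\varphi$. Consider the two conditions $$\text{(a)}\quad \bigcap_{i\in\Sigma_N}G_i^{-1}\left(\tfrac1N\right)\ne\emptyset ,\qquad\qquad \text{(b)}\quad \bigcap_{i\in\Sigma_N}G_i^{-1}\left(\tfrac1N\right)\subset\bigcap_{i\in\Sigma_N}\mathrm{Fix}(H_i).$$ (i) If either (a) or (b) fails, then $\dim_H\mu_\varphi<1$. (ii) If (a) and (b) both hold, then the distribution function of $\mu_\varphi$ is given by $$\varphi(x)=\frac{(N-1)x}{N-1-c_0N(x-1)}.$$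
   Context: Let $N\ge2$, $\Sigma_N=\{0,\dots,N-1\}$. For a real matrix $A=\begin{pmatrix}a&b\\c&d\end{pmatrix}$ put $\Phi(A;z)=\frac{az+b}{cz+d}$. Let $A_i=\begin{pmatrix}a_i&b_i\\c_i&d_i\end{pmatrix}$, $i\in\Sigma_N$, be real matrices, normalized so that $d_i=1$, satisfying: (A1) $\Phi(A_0;0)=0$, $\Phi(A_{N-1};1)=1$, and $\Phi(A_{i-1};1)=\Phi(A_i;0)$ for $i=1,\dots,N-1$; (A2) $a_id_i-b_ic_i>0$ for all $i$; (A3) $(a_id_i-b_ic_i)^{1/2}\le\min\{d_i,c_i+d_i\}$ for all $i$. Let $g_i(x)=\Phi(A_i;x)$ for $x\in[0,1]$. (These conditions guarantee that the functional equation has a unique continuous solution $\varphi:[0,1]\to[0,1]$, and imply $b_0=0$, $a_0\le 1$, and $0<b_i<1$ for $i\ge1$.) Let $$\alpha=\min\left\{0,\tfrac{c_0}{1-a_0},\tfrac{a_i-1+\sqrt{(1-a_i)^2+4b_ic_i}}{2b_i}: 1\le i\le N-1\right\},$$ $$\beta=\max\left\{0,\tfrac{c_0}{1-a_0},\tfrac{a_i-1+\sqrt{(1-a_i)^2+4b_ic_i}}{2b_i}: 1\le i\le N-1\right\},$$ where, if $a_0=1$, the term $c_0/(1-a_0)$ is replaced by $-1$ in $\alpha$ and by $+\infty$ in $\beta$. Let $Y=[\alpha,\beta]$. For $k\in\Sigma_N$, $y\in Y$ let $$G_k(y)=\frac{(a_k-b_kc_k)(y+1)}{(b_ky+1)\left((a_k+b_k)y+c_k+1\right)},\qquad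 H_k(y)=\frac{a_ky+c_k}{b_ky+1};$$ if $a_0=1$, put $G_0(+\infty)=1$, $G_k(+\infty)=0$ for $k\ge1$, $H_0(+\infty)=+\infty$, $H_k(+\infty)=a_k/b_k$ for $k\ge1$. If $-1\in Y$, then $G_{N-1}(-1)$ is given by continuous extension, i.e. $G_{N-1}(-1)=1$. $\mathrm{Fix}(f)$ is the set of fixed points of $f$ (in $Y$), and preimages $G_i^{-1}$ are taken in $Y$. For a Borel probability measure $\mu$ on $[0,1]$, $\dim_H\mu=\inf\{\dim_H B: B\text{ Borel},\ \mu(B)=1\}$. *)

(* Defs.v *)
From HB Require Import structures.
From mathcomp Require Import all_boot all_order all_algebra.
From mathcomp Require Import all_classical all_reals all_analysis.
Set Implicit Arguments.
Unset Strict Implicit.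
Unset Printing Implicit Defensive.
Import Order.TTheory GRing.Theory Num.Theory.
Import numFieldNormedType.Exports.
Local Open Scope classical_set_scope.
Local Open Scope ring_scope.

Section DeRham.
Variable R : realType.

Definition mxa (M : 'M[R]_2) : R := M 0 0.
Definition mxb (M : 'M[R]_2) : R := M 0 1.
Definition mxc (M : 'M[R]_2) : R := M 1 0.
Definition mxd (M : 'M[R]_2) : R := M 1 1.

Definition Phi (M : 'M[R]_2) (z : R) : R :=
  (mxa M * z + mxb M) / (mxc M * z + mxd M).

(* Families indexed by {0, ..., N-1} are functions on nat of which only the
   values at indices < N are ever used. *)
Record admissible (N : nat) (A : nat -> 'M[R]_2) : Prop := Admissible {
  adm_norm : forall i, (i < N)%N -> mxd (A i) = 1 ;
  adm_fix0 : Phi (A 0%N) 0 = 0 ;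
  adm_fix1 : Phi (A N.-1) 1 = 1 ;
  adm_glue : forall i, (i.+1 < N)%N -> Phi (A i) 1 = Phi (A i.+1) 0 ;
  adm_det : forall i, (i < N)%N ->
    0 < mxa (A i) * mxd (A i) - mxb (A i) * mxc (A i) ;
  adm_contr : forall i, (i < N)%N ->
    Num.sqrt (mxa (A i) * mxd (A i) - mxb (A i) * mxc (A i))
      <= Num.min (mxd (A i)) (mxc (A i) + mxd (A i)) }.

Record is_solution (N : nat) (A : nat -> 'M[R]_2) (phi : R -> R) : Prop :=
  IsSolution {
  sol_cont : {within `[0, 1], continuous phi} ;
  sol_range : forall x, 0 <= x <= 1 -> 0 <= phi x <= 1 ;
  sol_eq : forall i x, (i < N)%N -> i%:R / N%:R <= x <= i.+1%:R / N%:R ->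
    phi x = Phi (A i) (phi (N%:R * x - i%:R)) }.

Definition is_distribution_function
    (mu : probability (measurableTypeR R) R) (phi : R -> R) : Prop :=
  mu `[0, 1]%classic = 1%E /\ forall x, 0 <= x <= 1 -> mu `[0, x]%classic = (phi x)%:E.

Definition Yterm (M : 'M[R]_2) : R :=
  (mxa M - 1 + Num.sqrt ((1 - mxa M) ^+ 2 + 4 * mxb M * mxc M)) / (2 * mxb M).

(* The neutral element 0 of the iterated min / max accounts for the explicit
   member 0 of the set. *)
Definition Yalpha (N : nat) (A : nat -> 'M[R]_2) : R :=
  \big[Order.min/0]_(i < N)
    if i == 0%N :> nat then
      if mxa (A 0%N) == 1 then -1 else mxc (A 0%N) / (1 - mxa (A 0%N))
    else Yterm (A i).

Definition Ybeta (N : nat) (A : nat -> 'M[R]_2) : \bar R :=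
  \big[Order.max/0%E]_(i < N)
    if i == 0%N :> nat then
      if mxa (A 0%N) == 1 then +oo%E
      else (mxc (A 0%N) / (1 - mxa (A 0%N)))%:E
    else (Yterm (A i))%:E.

Definition Y (N : nat) (A : nat -> 'M[R]_2) : set (\bar R) :=
  [set y | ((Yalpha N A)%:E <= y <= Ybeta N A)%E].

(* The point +oo belongs to Y only when a_0 = 1, and -oo never does, so that
   the value at -oo is a dummy. *)
Definition G (N : nat) (A : nat -> 'M[R]_2) (k : nat) (y : \bar R) : R :=
  let: a := mxa (A k) in let: b := mxb (A k) in let: c := mxc (A k) in
  match y with
  | r%:E => if (k == N.-1) && (r == -1) then 1 else
      ((a - b * c) * (r + 1)) / ((b * r + 1) * ((a + b) * r + c + 1))
  | +oo%E => if k == 0%N then 1 else 0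
  | -oo%E => 0
  end.

Definition H (A : nat -> 'M[R]_2) (k : nat) (y : \bar R) : \bar R :=
  let: a := mxa (A k) in let: b := mxb (A k) in let: c := mxc (A k) in
  match y with
  | r%:E => ((a * r + c) / (b * r + 1))%:E
  | +oo%E => if k == 0%N then +oo%E else (a / b)%:E
  | -oo%E => 0%E
  end.

Definition Gpreim (N : nat) (A : nat -> 'M[R]_2) (k : nat) (t : R) :
    set (\bar R) :=
  Y N A `&` [set y | G N A k y = t].

Definition FixH (N : nat) (A : nat -> 'M[R]_2) (k : nat) : set (\bar R) :=
  Y N A `&` [set y | H A k y = y].

Definition bigcapG (N : nat) (A : nat -> 'M[R]_2) : set (\bar R) :=
  \bigcap_(k in `I_N) Gpreim N A k (N%:R^-1).

Definition condition_a (N : nat) (A : nat -> 'M[R]_2) : Prop :=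
  bigcapG N A !=set0.

Definition condition_b (N : nat) (A : nat -> 'M[R]_2) : Prop :=
  bigcapG N A `<=` \bigcap_(k in `I_N) FixH N A k.

Definition diam (U : set R) : \bar R :=
  ereal_sup [set (`|p.1 - p.2|)%:E | p in U `*` U].

(* diam(U)^s, with the empty set contributing 0 for every s >= 0 (the
   supremum defining its diameter is -oo). *)
Definition hgauge (s : R) (U : set R) : \bar R :=
  if `[< U = set0 >] then 0%E else poweR (diam U) s.

Definition hausdorff_pre (s delta : R) (B : set R) : \bar R :=
  ereal_inf [set (\sum_(0 <= k <oo) hgauge s (U k))%E | U in
    [set U : nat -> set R | (forall k, (diam (U k) <= delta%:E)%E) /\
                            B `<=` \bigcup_k U k]].

Definition hausdorff_measure (s : R) (B : set R) : \bar R :=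
  ereal_sup [set hausdorff_pre s delta B | delta in [set delta | 0 < delta]].

Definition hausdorff_dim (B : set R) : \bar R :=
  ereal_inf [set s%:E | s in
    [set s : R | 0 <= s /\ hausdorff_measure s B = 0%E]].

(* Meant for probabilities carried by [0, 1], so B ranges over the Borel
   subsets of [0, 1]. *)
Definition measure_dim (mu : probability (measurableTypeR R) R) : \bar R :=
  ereal_inf [set hausdorff_dim B | B in
    [set B : set (measurableTypeR R) |
      [/\ measurable B, B `<=` `[0, 1]%classic & mu B = 1%E]]].

End DeRham.

(* Main.v *)
Require Import Defs.
From HB Require Import structures.
From mathcomp Require Import all_boot all_order all_algebra.
From mathcomp Require Import all_classical all_reals all_analysis.
From mathcomp Require Import ring lra.
Import Order.TTheory GRing.Theory Num.Theory.
Import numFieldNormedType.Exports.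
Local Open Scope classical_set_scope.
Local Open Scope ring_scope.

(* For y > -1 the Moebius map [mob y] is an increasing bijection of [0, 1], and
   mob y (g_k z) = mob y (b_k) + G_k(y) mob (H_k y) z. So the mass that the
   distribution function mob y o phi gives to an N-adic cell is a product of
   values of the G_k along the orbit of y under the H_k, and G_0, ..., G_{N-1}
   sum to 1 at every y > -1. There is exactly one ystar > -1 with
   G_0(ystar) = 1/N, and (a) and (b) hold together iff all G_k(ystar) are 1/N
   and all H_k fix ystar.
   (ii) In that case E(x) = mob ystar (phi x) - x satisfies
   E(x) = E(N x - i) / N, hence vanishes.
   (i) Otherwise the two-step sum of sqrt(G_k(y) G_l(H_k y)) over k, l, which
   is at most N by Cauchy-Schwarz, is at most some rho < N uniformly in
   y > -1. Hence the square roots of the masses of the cells of level 2n add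
   up to at most rho^n, exponentially less than N^n. By Borel-Cantelli almost
   every point eventually lies only in cells of large mass, and there are too
   few of these for dimension 1. *)

(** * The Moebius maps [mob y] and their conjugation identity *)

Section Mobius.
Context {R : realType}.
Implicit Types (M : 'M[R]_2) (y z : R).

(** [mxb M] is the left endpoint [Phi M 0] of the image of [[0, 1]]; [cell_le1] is [Phi M 1 <= 1]
    with the denominator cleared. *)
Record contracting_cell M : Prop := ContractingCell {
  cell_d : mxd M = 1 ;
  cell_det : 0 < mxa M - mxb M * mxc M ;
  cell_b0 : 0 <= mxb M ;
  cell_b1 : mxb M < 1 ;
  cell_c : 0 < mxc M + 1 ;
  cell_le1 : mxa M + mxb M <= mxc M + 1 }.

Definition mob y z : R := (1 + y) * z / (y * z + 1).

Definition Gfin M y : R :=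
  (mxa M - mxb M * mxc M) * (y + 1)
    / ((mxb M * y + 1) * ((mxa M + mxb M) * y + mxc M + 1)).

Definition Hfin M y : R := (mxa M * y + mxc M) / (mxb M * y + 1).

(** The denominator is the convex combination of [1 + y] and [1] with weights [z] and [1 - z]. *)
Lemma mob_den_gt0 {y z} : -1 < y -> 0 <= z <= 1 -> 0 < y * z + 1.
Proof.
move=> y1 /andP[z0 z1].
have -> : y * z + 1 = (y + 1) * z + (1 - z) by ring.
have [->|zn1] := eqVneq z 1; first by lra.
have z1' : z < 1 by rewrite lt_neqAle zn1.
by apply: ltr_wpDl; [apply: mulr_ge0 => //; lra|lra].
Qed.

Lemma mob0 z : mob 0 z = z.
Proof. by rewrite /mob mul0r add0r addr0 mul1r divr1. Qed.

Lemma mob_1 y : -1 < y -> mob y 1 = 1.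
Proof. by move=> y1; rewrite /mob !mulr1 [1 + y]addrC divff//; lra. Qed.

Lemma mob_ge0 y z : -1 < y -> 0 <= z <= 1 -> 0 <= mob y z.
Proof.
move=> y1 z01; rewrite divr_ge0 ?(ltW (mob_den_gt0 _ _))//.
by case/andP: z01 => z0 _; rewrite mulr_ge0//; lra.
Qed.

Lemma mob_le {y z z'} : -1 < y -> 0 <= z -> z <= z' -> z' <= 1 ->
  mob y z <= mob y z'.
Proof.
move=> y1 z0 zz' z'1.
have d : 0 < y * z + 1 by apply: mob_den_gt0 => //; lra.
have d' : 0 < y * z' + 1 by apply: mob_den_gt0 => //; lra.
rewrite ler_pdivrMr// mulrAC ler_pdivlMr// -!mulrA.
by apply: ler_wpM2l; [lra|nra].
Qed.

Lemma mob_le1 {y z} : -1 < y -> 0 <= z <= 1 -> mob y z <= 1.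
Proof.
by move=> y1 /andP[z0 z1]; rewrite -[leRHS](mob_1 y)//; apply: mob_le.
Qed.

Lemma cell_den1 {M y} : contracting_cell M -> -1 < y -> 0 < mxb M * y + 1.
Proof.
by move=> [_ _ b0 b1 _ _] y1; rewrite mulrC; apply: mob_den_gt0 => //; lra.
Qed.

Lemma cell_den2 {M y} : contracting_cell M -> -1 < y ->
  0 < (mxa M + mxb M) * y + mxc M + 1.
Proof.
move=> [_ dt b0 b1 c1 ab] y1.
(* The determinant condition gives [mxa M + mxb M > mxb M * (mxc M + 1) >= 0]. *)
have ab0 : 0 < mxa M + mxb M by nra.
have : 0 < (mxa M + mxb M) * (y + 1) by apply: mulr_gt0 => //; lra.
by lra.
Qed.

Lemma cell_den {M z} : contracting_cell M -> 0 <= z <= 1 -> 0 < mxc M * z + 1.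
Proof. by move=> [_ _ _ _ c1 _] z01; apply: mob_den_gt0 => //; lra. Qed.

Lemma Gfin_gt0 {M y} : contracting_cell M -> -1 < y -> 0 < Gfin M y.
Proof.
move=> cM y1; apply: divr_gt0.
  by apply: mulr_gt0; [exact: cell_det|lra].
by apply: mulr_gt0; [exact: cell_den1|exact: cell_den2].
Qed.

(** [Hfin M y + 1] is the quotient of the two positive factors in the denominator of [Gfin M y]. *)
Lemma Hfin_gtN1 {M y} : contracting_cell M -> -1 < y -> -1 < Hfin M y.
Proof.
move=> cM y1; have d1 := cell_den1 cM y1; have d2 := cell_den2 cM y1.
by rewrite /Hfin ltr_pdivlMr//; lra.
Qed.

(** As functions of [z], [mob y (Phi M z)] and [mob (Hfin M y) z] have the same pole, so they differ
    by an affine map. Since [mob (Hfin M y)] fixes [0] and [1], its coefficients are the value at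
    [0] and the increment over [[0, 1]]. *)
Lemma mob_Phi {M y z} : contracting_cell M -> -1 < y -> 0 <= z <= 1 ->
  mob y (Phi M z) = mob y (mxb M) + Gfin M y * mob (Hfin M y) z.
Proof.
move=> cM y1 z01.
have d1 := cell_den1 cM y1; have d2 := cell_den2 cM y1.
have dz := cell_den cM z01.
have dH := mob_den_gt0 (Hfin_gtN1 cM y1) z01.
have dH' : 0 < (mxa M * y + mxc M) * z + (mxb M * y + 1).
  have := mulr_gt0 dH d1; rewrite /Hfin.
  by rewrite mulrDl mul1r mulrAC divfK// gt_eqF.
rewrite /mob /Gfin /Phi (cell_d _ cM) /Hfin.
field.
by rewrite !gt_eqF//; lra.
Qed.

End Mobius.

(** * Consequences of (A1)-(A3) and the point [ystar] *)

Section Admissible.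
Context {R : realType} (N : nat) (A : nat -> 'M[R]_2).
Hypotheses (hN : (2 <= N)%N) (hA : admissible N A).

Lemma admissible_c {k} : (k < N)%N -> 0 < mxc (A k) + 1.
Proof.
move=> kN; have := adm_contr hA kN; rewrite le_min => /andP[_].
rewrite (adm_norm hA kN); apply: lt_le_trans; rewrite sqrtr_gt0.
by have := adm_det hA kN; rewrite (adm_norm hA kN).
Qed.

Lemma admissible_b_lt {k} : (k < N)%N -> mxb (A k) < Phi (A k) 1.
Proof.
move=> kN; have c1 := admissible_c kN; have := adm_det hA kN.
rewrite /Phi (adm_norm hA kN) !mulr1 => dt.
by rewrite ltr_pdivlMr//; lra.
Qed.

Lemma admissible_bS {k} : (k.+1 < N)%N -> mxb (A k.+1) = Phi (A k) 1.
Proof.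
move=> kN; rewrite (adm_glue hA kN) /Phi (adm_norm hA kN) !mulr0 !add0r.
by rewrite divr1.
Qed.

Lemma admissible_b0 : mxb (A 0%N) = 0.
Proof.
have := adm_fix0 hA; rewrite /Phi (adm_norm hA) ?(ltnW hN)//.
by rewrite !mulr0 !add0r divr1.
Qed.

Lemma admissible_b_ge0 {k} : (k < N)%N -> 0 <= mxb (A k).
Proof.
elim: k => [|k IH] kN; first by rewrite admissible_b0.
rewrite admissible_bS//; apply: (le_trans (IH (ltnW kN))).
exact: ltW (admissible_b_lt (ltnW kN)).
Qed.

Lemma admissible_Phi1_le1 {k} : (k < N)%N -> Phi (A k) 1 <= 1.
Proof.
(* Downward induction from the last cell, whose right endpoint is [1]. *)
move=> kN; have -> : k = (N.-1 - (N.-1 - k))%N.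
  by rewrite subKn// -ltnS prednK// ltnW.
elim: (N.-1 - k)%N => [|j IH]; first by rewrite subn0 (adm_fix1 hA).
(* Truncated subtraction: from [j = N.-1] on the index stays at [0]. *)
have [jN|jN] := ltnP j N.-1; last first.
  suff -> : (N.-1 - j.+1 = N.-1 - j)%N by [].
  by move: jN; rewrite -subn_eq0 => /eqP e; rewrite subnS e.
have e : (N.-1 - j = (N.-1 - j.+1).+1)%N by rewrite subnSK.
have lN : (N.-1 - j < N)%N.
  by rewrite (leq_ltn_trans (leq_subr _ _))// prednK// ltnW.
apply: le_trans IH; rewrite e -admissible_bS -?e//.
by apply/ltW; apply: admissible_b_lt.
Qed.

Lemma admissible_cell {k} : (k < N)%N -> contracting_cell (A k).
Proof.
move=> kN; have d1 := adm_norm hA kN; have c1 := admissible_c kN.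
have ble := admissible_Phi1_le1 kN.
split=> //.
- by have := adm_det hA kN; rewrite d1 mulr1.
- exact: admissible_b_ge0.
- exact: lt_le_trans (admissible_b_lt kN) ble.
- by move: ble; rewrite /Phi d1 !mulr1 ler_pdivrMr// mul1r.
Qed.

(** As [N >= 2], the right endpoint of cell [0] is the left endpoint of cell [1], which is strictly
    below [1]. *)
Lemma admissible_a0_lt : mxa (A 0%N) < mxc (A 0%N) + 1.
Proof.
have c1 := admissible_c (ltnW hN).
have := cell_b1 _ (admissible_cell hN); rewrite admissible_bS//.
rewrite /Phi (adm_norm hA (ltnW hN)) admissible_b0 !mulr1 addr0.
by rewrite ltr_pdivrMr// mul1r.
Qed.

Lemma admissible_a0_gt0 : 0 < mxa (A 0%N).
Proof.
have := cell_det _ (admissible_cell (ltnW hN)).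
by rewrite admissible_b0 mul0r subr0.
Qed.

Lemma Gfin_mob {k y} : (k < N)%N -> -1 < y ->
  mob y (Phi (A k) 1) = mob y (mxb (A k)) + Gfin (A k) y.
Proof.
move=> kN y1; have cM := admissible_cell kN.
by rewrite mob_Phi// ?ler01 ?lexx// mob_1 ?mulr1//; apply: Hfin_gtN1.
Qed.

(** Telescoping: [Gfin (A i) y] is the increment of [mob y] between the endpoints of cell [i], and
    consecutive cells share an endpoint. *)
Lemma mob_b {k y} : (k < N)%N -> -1 < y ->
  mob y (mxb (A k)) = \sum_(i < k) Gfin (A i) y.
Proof.
move=> + y1; elim: k => [|k IH] kN.
  by rewrite big_ord0 admissible_b0 /mob mulr0 mul0r.
by rewrite admissible_bS// Gfin_mob ?(ltnW kN)// big_ord_recr /= IH// ltnW.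
Qed.

Lemma sum_Gfin {y} : -1 < y -> \sum_(k < N) Gfin (A k) y = 1.
Proof.
move=> y1; have e : N = N.-1.+1 by rewrite prednK// ltnW.
have lN : (N.-1 < N)%N by rewrite -e.
rewrite -(big_mkord xpredT (fun k => Gfin (A k) y)).
rewrite [X in index_iota _ X]e big_nat_recr//= big_mkord.
by rewrite -mob_b// -Gfin_mob// (adm_fix1 hA) mob_1.
Qed.

Lemma Gfin0 y : Gfin (A 0%N) y =
  mxa (A 0%N) * (y + 1) / (mxa (A 0%N) * y + mxc (A 0%N) + 1).
Proof. by rewrite /Gfin admissible_b0 !mul0r subr0 addr0 add0r mul1r. Qed.

Lemma Gfin0_lt {y y'} : -1 < y -> y < y' ->
  Gfin (A 0%N) y < Gfin (A 0%N) y'.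
Proof.
move=> y1 yy'; have cM := admissible_cell (ltnW hN).
have d := cell_den2 cM y1; have d' := cell_den2 cM (lt_trans y1 yy').
move: d d'; rewrite admissible_b0 addr0 => d d'.
have a0 := admissible_a0_gt0; have ac := admissible_a0_lt.
rewrite !Gfin0 ltr_pdivrMr// mulrAC ltr_pdivlMr// -!mulrA ltr_pM2l//.
have : 0 < (y' - y) * (mxc (A 0%N) + 1 - mxa (A 0%N)).
  by apply: mulr_gt0; lra.
by lra.
Qed.

(** The root of [Gfin (A 0%N) y = N%:R^-1], an equation that is linear in [y] once the denominator
    is cleared. *)
Definition ystar : R :=
  (mxc (A 0%N) + 1 - N%:R * mxa (A 0%N)) / (mxa (A 0%N) * (N%:R - 1)).

Lemma base_gt1 : 1 < N%:R :> R.
Proof. by rewrite ltr1n. Qed.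

Lemma ystar_gtN1 : -1 < ystar.
Proof.
have := base_gt1; have a0 := admissible_a0_gt0; have ac := admissible_a0_lt.
move=> n1; rewrite /ystar ltr_pdivlMr; first by lra.
by apply: mulr_gt0 => //; lra.
Qed.

Lemma Gfin0_ystar : Gfin (A 0%N) ystar = N%:R^-1.
Proof.
have n1 := base_gt1; have a0 := admissible_a0_gt0; have ac := admissible_a0_lt.
rewrite Gfin0 /ystar; field.
by rewrite !gt_eqF//; nra.
Qed.

Lemma Gfin0_inj {y} : Gfin (A 0%N) y = N%:R^-1 -> y = ystar.
Proof.
have n1 := base_gt1; have a0 := admissible_a0_gt0; have ac := admissible_a0_lt.
rewrite Gfin0 => e.
(* Division by zero yields [0], which is not [1 / N]. *)
have dn : mxa (A 0%N) * y + mxc (A 0%N) + 1 != 0.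
  by apply/eqP => d0; move: e; rewrite d0 invr0 mulr0 => /esym/eqP;
    rewrite invr_eq0 gt_eqF//; lra.
have {}e : N%:R * (mxa (A 0%N) * (y + 1)) = mxa (A 0%N) * y + mxc (A 0%N) + 1.
  rewrite -[X in N%:R * X](divfK dn) e mulrA divff ?mul1r// gt_eqF//; lra.
apply: (@mulIf _ (mxa (A 0%N) * (N%:R - 1))).
  by rewrite gt_eqF// mulr_gt0//; lra.
rewrite divfK; first by lra.
by rewrite gt_eqF// mulr_gt0//; lra.
Qed.

End Admissible.

(** * The functional equation in conjugated form *)

Section Conjugation.
Context {R : realType} (N : nat) (A : nat -> 'M[R]_2) (phi : R -> R).
Hypotheses (hN : (2 <= N)%N) (hA : admissible N A) (hphi : is_solution N A phi).
Implicit Types (x y z : R).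

Lemma base_gt0 : 0 < N%:R :> R.
Proof. by rewrite ltr0n ltnW. Qed.

Lemma exists_cell x : 0 <= x <= 1 ->
  exists2 i, (i < N)%N & i%:R / N%:R <= x <= i.+1%:R / N%:R.
Proof.
move=> /andP[x0 x1]; have n0 := base_gt0.
(* Truncating [N * x] would give the invalid index [N] at [x = 1], so the last cell is chosen
   there. *)
have [x1'|x1'] := ltP x 1; last first.
  exists N.-1; first by rewrite prednK// ltnW.
  have -> : x = 1 by lra.
  rewrite prednK ?(ltnW hN)// divff ?gt_eqF// lexx andbT.
  by rewrite ler_pdivrMr// mul1r ler_nat leq_pred.
exists (Num.trunc (x * N%:R)).
  by rewrite truncn_lt_nat ?mulr_ge0 ?ler0n// gtr_pMl.
have xN0 : 0 <= x * N%:R by rewrite mulr_ge0// ltW.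
rewrite ler_pdivrMr// ler_pdivlMr//.
by rewrite -truncn_ge_nat// leqnn /= ltW// -truncn_lt_nat.
Qed.

Lemma cell_range {i x} : i%:R / N%:R <= x <= i.+1%:R / N%:R ->
  0 <= N%:R * x - i%:R <= 1.
Proof.
have n0 := base_gt0; rewrite ler_pdivrMr// ler_pdivlMr// mulrS => /andP[h1 h2].
by rewrite mulrC; apply/andP; split; lra.
Qed.

Lemma mob_phi_eq_id y : -1 < y ->
  (forall k, (k < N)%N -> Gfin (A k) y = N%:R^-1) ->
  (forall k, (k < N)%N -> Hfin (A k) y = y) ->
  forall x, 0 <= x <= 1 -> mob y (phi x) = x.
Proof.
move=> y1 hG hH; have n0 := base_gt0.
(* Both terms lie in [[0, 1]], and each use of the functional equation divides the error by [N],
   since [mob y (mxb (A i))] is a sum of [i] copies of [1 / N]. *)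
have dist n : forall x, 0 <= x <= 1 -> `|mob y (phi x) - x| <= N%:R ^- n.
  elim: n => [|n IH] x x01.
    rewrite expr0 invr1 ler_norml.
    have p01 := sol_range hphi x01.
    have := mob_ge0 y _ y1 p01; have := mob_le1 y1 p01.
    by case/andP: x01 => *; apply/andP; split; lra.
  have [i iN ix] := exists_cell _ x01; have x'01 := cell_range ix.
  rewrite (sol_eq hphi iN ix) (mob_Phi (admissible_cell _ _ hN hA iN))//; last first.
    exact: (sol_range hphi).
  rewrite (hG _ iN) (hH _ iN) (mob_b _ _ hN hA iN y1).
  rewrite (eq_bigr (fun=> N%:R^-1)) => [|k _]; last first.
    by apply: hG; apply: ltn_trans (ltn_ord k) iN.
  rewrite sumr_const card_ord -(mulr_natl N%:R^-1).
  have -> : i%:R * N%:R^-1 + N%:R^-1 * mob y (phi (N%:R * x - i%:R)) - x =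
    N%:R^-1 * (mob y (phi (N%:R * x - i%:R)) - (N%:R * x - i%:R)).
    by field; rewrite gt_eqF.
  rewrite normrM ger0_norm ?invr_ge0 ?(ltW n0)// exprS invfM.
  by rewrite ler_pM2l ?invr_gt0//; apply: IH.
move=> x x01; apply/eqP; rewrite -subr_eq0 -normr_le0 leNgt; apply/negP => e0.
set e := `|_| in e0.
(* With [m] the bound of [e^-1], this gives [e^-1 < 2 ^ m], against [e <= N ^- m <= 2 ^- m]. *)
have := upper_nthrootP (leqnn (Num.bound e^-1)).
rewrite ltNge => /negP; apply.
rewrite -[leLHS]invrK lef_pV2 ?posrE ?invr_gt0 ?exprn_gt0//.
apply: le_trans (dist (Num.bound e^-1) x x01) _.
rewrite lef_pV2 ?posrE ?exprn_gt0//.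
by apply: lerXn2r; rewrite ?nnegrE ?(ltW n0)// ler_nat.
Qed.

(** The map [x -> N x - k] sends this point of cell [k] to a grid point one level lower. The value
    [j = N ^ n] is included to reach the right endpoint of the cell. *)
Lemma phi_grid_rec {n k j} : (k < N)%N -> (j <= N ^ n)%N ->
  phi ((k * N ^ n + j)%:R / N%:R ^+ n.+1) = Phi (A k) (phi (j%:R / N%:R ^+ n)).
Proof.
move=> kN jN; have n0 := base_gt0; have nn0 : 0 < N%:R ^+ n :> R by rewrite exprn_gt0.
set x := (X in phi X = _).
have ex : N%:R * x - k%:R = j%:R / N%:R ^+ n.
  rewrite /x exprS natrD natrM natrX; field.
  by rewrite !gt_eqF.
rewrite (sol_eq hphi kN) ?ex//.
have j0 : 0 <= j%:R / N%:R ^+ n :> R by rewrite divr_ge0 ?ler0n// ltW.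
have j1 : j%:R / N%:R ^+ n <= 1 :> R.
  by rewrite ler_pdivrMr// mul1r -natrX ler_nat.
by rewrite ler_pdivrMr// ler_pdivlMr// mulrS mulrC; lra.
Qed.

Lemma grid_01 {n j} : (j <= N ^ n)%N -> 0 <= (j%:R / N%:R ^+ n : R) <= 1.
Proof.
move=> jN; have n0 := base_gt0; have nn0 : 0 < N%:R ^+ n :> R by rewrite exprn_gt0.
by rewrite divr_ge0 ?ler0n ?(ltW nn0)//= ler_pdivrMr// mul1r -natrX ler_nat.
Qed.

(** The mass of the [j]-th cell of level [n] under the distribution function [mob y (phi x)]. *)
Definition grid_mass y n j : R :=
  mob y (phi (j.+1%:R / N%:R ^+ n)) - mob y (phi (j%:R / N%:R ^+ n)).

Definition root_sum y n : R := \sum_(0 <= j < N ^ n) Num.sqrt (grid_mass y n j).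

(** Write the cell index as [k * N ^ n + j]. By [mob_Phi] the constant terms cancel in the
    difference, and the mass factors as [Gfin (A k) y] times a mass of level [n] at
    [Hfin (A k) y]. *)
Lemma root_sum_rec y n : -1 < y -> root_sum y n.+1 =
  \sum_(k < N) Num.sqrt (Gfin (A k) y) * root_sum (Hfin (A k) y) n.
Proof.
move=> y1; rewrite /root_sum expnS big_nat_mul big_mkord.
apply: eq_bigr => k _; have kN := ltn_ord k.
have cM := admissible_cell _ _ hN hA kN.
rewrite mulSn -{1}[(k * _)%N]add0n [(N ^ n + _)%N]addnC big_addn.
rewrite addKn mulr_sumr; apply: eq_big_nat => j /andP[_ jN].
rewrite -sqrtrM ?ltW ?(Gfin_gt0 cM)//; congr Num.sqrt.
rewrite /grid_mass addnC -addnS !phi_grid_rec ?(ltnW jN)//.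
rewrite !(mob_Phi cM)//; try by apply: (sol_range hphi); apply: grid_01; rewrite // ltnW.
by ring.
Qed.

End Conjugation.

(** * A uniform gap in the two-step Cauchy-Schwarz inequality *)

Section Contraction.
Context {R : realType} (N : nat) (A : nat -> 'M[R]_2).
Hypotheses (hN : (2 <= N)%N) (hA : admissible N A).
Implicit Types (x y z : R).

(** Cauchy-Schwarz with a defect: expand the sum of the squares of [sqrt (p k) - 1 / sqrt N] and
    keep only its [i]-th term as a lower bound. *)
Lemma sum_sqrt_le (p : 'I_N -> R) i : (forall k, 0 <= p k) -> \sum_k p k = 1 ->
  \sum_k Num.sqrt (p k) <=
    Num.sqrt N%:R * (1 - (Num.sqrt (p i) - (Num.sqrt N%:R)^-1) ^+ 2 / 2).
Proof.
move=> p0 p1; set r := Num.sqrt N%:R.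
have r0 : 0 < r by rewrite sqrtr_gt0 ltr0n ltnW.
have r2 : r ^+ 2 = N%:R by rewrite sqr_sqrtr// ler0n.
have e : \sum_k (Num.sqrt (p k) - r^-1) ^+ 2 =
    2 - 2 * r^-1 * \sum_k Num.sqrt (p k).
  under eq_bigr => k _.
    have -> : (Num.sqrt (p k) - r^-1) ^+ 2 =
        p k - 2 * r^-1 * Num.sqrt (p k) + N%:R^-1.
      by rewrite sqrrB sqr_sqrtr// exprVn r2; ring.
    over.
  rewrite big_split /= sumrB p1 sumr_const card_ord -mulr_sumr.
  rewrite -(mulr_natl N%:R^-1) divff; last by rewrite pnatr_eq0 -lt0n ltnW.
  ring.
have : (Num.sqrt (p i) - r^-1) ^+ 2 <= \sum_k (Num.sqrt (p k) - r^-1) ^+ 2.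
  rewrite (bigD1 i)//= lerDl; apply: sumr_ge0 => k _; exact: sqr_ge0.
rewrite e => le; set S := \sum_k _ in le *.
have -> : S = r * (r^-1 * S) by rewrite mulrA divff ?mul1r// gt_eqF.
rewrite ler_pM2l//. lra.
Qed.

Definition root1 y : R := \sum_(k < N) Num.sqrt (Gfin (A k) y).

(** Two steps are taken because at [ystar] every [Gfin] may equal [1 / N], so that one step loses
    nothing, while some [Hfin] moves [ystar]. *)
Definition root2 y : R :=
  \sum_(k < N) Num.sqrt (Gfin (A k) y) * root1 (Hfin (A k) y).

Let r : R := Num.sqrt N%:R.

Lemma sqrtN_gt0 : 0 < r.
Proof. by rewrite sqrtr_gt0 ltr0n ltnW. Qed.

Lemma root1_le_gap y i : (i < N)%N -> -1 < y ->
  root1 y <= r * (1 - (Num.sqrt (Gfin (A i) y) - r^-1) ^+ 2 / 2).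
Proof.
move=> iN y1.
apply: (sum_sqrt_le (fun k : 'I_N => Gfin (A k) y) (Ordinal iN)).
  by move=> k; apply/ltW/Gfin_gt0 => //; apply: (admissible_cell _ _ hN hA).
exact: (sum_Gfin _ _ hN hA).
Qed.

Lemma root1_le y : -1 < y -> root1 y <= r.
Proof.
move=> y1; apply: le_trans (root1_le_gap y 0 (ltnW hN) y1) _.
apply: ler_piMr; first exact: ltW sqrtN_gt0.
by rewrite gerBl divr_ge0// sqr_ge0.
Qed.

Lemma root1_lt y i : (i < N)%N -> -1 < y -> Gfin (A i) y != N%:R^-1 ->
  root1 y < r.
Proof.
move=> iN y1 ne; apply: le_lt_trans (root1_le_gap y i iN y1) _.
have r0 := sqrtN_gt0.
rewrite gtr_pMr// ltrBlDr ltrDl divr_gt0// exprn_even_gt0//= subr_eq0.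
apply: contraNneq ne => e.
have cM := admissible_cell _ _ hN hA iN.
rewrite -(sqr_sqrtr (ltW (Gfin_gt0 cM y1))) e exprVn sqr_sqrtr// ler0n.
Qed.

Lemma root1_ge0 y : 0 <= root1 y.
Proof. by apply: sumr_ge0 => k _; exact: sqrtr_ge0. Qed.

Lemma Hfin_gt {k y} : (k < N)%N -> -1 < y -> -1 < Hfin (A k) y.
Proof. by move=> kN y1; apply: Hfin_gtN1 => //; apply: (admissible_cell _ _ hN hA). Qed.

Lemma root2_le y : -1 < y -> root2 y <= r * root1 y.
Proof.
move=> y1; rewrite mulr_sumr; apply: ler_sum => k _; rewrite mulrC.
by apply: ler_wpM2r; [exact: sqrtr_ge0|apply: root1_le; exact: Hfin_gt].
Qed.

Lemma root2_le_gap y i : (i < N)%N -> -1 < y ->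
  root2 y <= N%:R * (1 - (Num.sqrt (Gfin (A i) y) - r^-1) ^+ 2 / 2).
Proof.
move=> iN y1; apply: le_trans (root2_le y y1) _.
have -> : N%:R = r * r by rewrite -expr2 sqr_sqrtr// ler0n.
by rewrite -mulrA ler_pM2l ?sqrtN_gt0//; apply: root1_le_gap.
Qed.

Local Notation ystar := (ystar N A).

(** If some [Gfin] differs from [1 / N] at [ystar], the first step loses. Otherwise some [Hfin]
    moves [ystar]; by uniqueness of [ystar], [Gfin (A 0%N)] is not [1 / N] at the new point, and the
    second step loses. *)
Lemma root2_ystar_lt :
  ~ (forall k, (k < N)%N -> Gfin (A k) ystar = N%:R^-1 /\ Hfin (A k) ystar = ystar) ->
  root2 ystar < N%:R.
Proof.
move=> nGH; have y1 := ystar_gtN1 _ _ hN hA; have r0 := sqrtN_gt0.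
have rr : N%:R = r * r by rewrite -expr2 sqr_sqrtr// ler0n.
have [hG|] := pselect (forall k, (k < N)%N -> Gfin (A k) ystar = N%:R^-1); last first.
  move=> /existsNP[i /not_implyP[iN /eqP ne]].
  apply: le_lt_trans (root2_le _ y1) _; rewrite rr ltr_pM2l//.
  exact: root1_lt ne.
have [i [iN ne]] : exists i, (i < N)%N /\ Hfin (A i) ystar <> ystar.
  apply: contrapT => nex; apply: nGH => k kN; split; first exact: hG.
  by apply: contrapT => ne; apply: nex; exists k.
have lt1 : root1 (Hfin (A i) ystar) < r.
  apply: (root1_lt _ 0%N (ltnW hN)); first exact: Hfin_gt.
  apply/eqP => /(Gfin0_inj _ _ hN hA); exact: ne.
rewrite rr; apply: lt_le_trans (_ : r * root1 ystar <= _); last first.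
  by rewrite ler_pM2l// root1_le.
rewrite mulr_sumr /root2 (bigD1 (Ordinal iN))//= [ltRHS](bigD1 (Ordinal iN))//=.
apply: ltr_leD; rewrite ?[r * _]mulrC.
  rewrite ltr_pM2l// sqrtr_gt0; apply: Gfin_gt0 => //.
  exact: (admissible_cell _ _ hN hA).
apply: ler_sum => k _; rewrite [r * _]mulrC.
by apply: ler_wpM2l; [exact: sqrtr_ge0|apply: root1_le; exact: Hfin_gt].
Qed.

Lemma Gfin_cont k y : (k < N)%N -> -1 < y -> {for y, continuous (Gfin (A k))}.
Proof.
move=> kN y1; have cM := admissible_cell _ _ hN hA kN.
have d1 := cell_den1 cM y1; have d2 := cell_den2 cM y1.
apply: cvgM; first by apply: cvgMl_tmp; apply: cvgD; [exact: cvg_id|exact: cvg_cst].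
apply: cvgV; first by rewrite gt_eqF ?mulr_gt0.
apply: cvgM.
  by apply: cvgD; [apply: cvgMl_tmp; exact: cvg_id|exact: cvg_cst].
apply: cvgD; last exact: cvg_cst.
by apply: cvgD; [apply: cvgMl_tmp; exact: cvg_id|exact: cvg_cst].
Qed.

Lemma Hfin_cont k y : (k < N)%N -> -1 < y -> {for y, continuous (Hfin (A k))}.
Proof.
move=> kN y1; have cM := admissible_cell _ _ hN hA kN.
have d1 := cell_den1 cM y1.
apply: cvgM; first by apply: cvgD; [apply: cvgMl_tmp; exact: cvg_id|exact: cvg_cst].
apply: cvgV; first by rewrite gt_eqF.
by apply: cvgD; [apply: cvgMl_tmp; exact: cvg_id|exact: cvg_cst].
Qed.

Lemma root1_cont y : -1 < y -> {for y, continuous root1}.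
Proof.
move=> y1; apply: cvg_big => [|k _]; first exact: add_continuous.
by apply: (@continuous_comp _ _ _ (Gfin (A k)) (@Num.sqrt R));
  [exact: Gfin_cont|exact: sqrt_continuous].
Qed.

Lemma root2_cont y : -1 < y -> {for y, continuous root2}.
Proof.
move=> y1; apply: cvg_big => [|k _]; first exact: add_continuous.
apply: cvgM.
  by apply: (@continuous_comp _ _ _ (Gfin (A k)) (@Num.sqrt R));
    [exact: Gfin_cont|exact: sqrt_continuous].
by apply: (@continuous_comp _ _ _ (Hfin (A k)) root1);
  [exact: Hfin_cont|apply: root1_cont; exact: Hfin_gt].
Qed.

(* Near [ystar] this is continuity; away from [ystar] the monotone function [G_0]
   stays away from [1/N]. *)
Lemma root2_unif :
  ~ (forall k, (k < N)%N -> Gfin (A k) ystar = N%:R^-1 /\ Hfin (A k) ystar = ystar) ->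
  exists2 rho, rho < N%:R & forall y, -1 < y -> root2 y <= rho.
Proof.
move=> nGH; have y1 := ystar_gtN1 _ _ hN hA; have r0 := sqrtN_gt0.
have lt0 := root2_ystar_lt nGH.
have /(cvgr_lt (root2 ystar)) /(_ _ (midf_lt lt0).1) := root2_cont _ y1.
move=> /nbhs_ballP[d /= d0 hd].
(* The second bound keeps [ystar - e] above [-1]. *)
pose e := Num.min d ((ystar + 1) / 2).
have e0 : 0 < e by rewrite lt_min d0 /=; lra.
have [ed ey] : e <= d /\ e <= (ystar + 1) / 2 by rewrite !ge_min !lexx orbT.
pose gap y := N%:R * (1 - (Num.sqrt (Gfin (A 0%N) y) - r^-1) ^+ 2 / 2).
have sG0 : Num.sqrt (Gfin (A 0%N) ystar) = r^-1.
  by rewrite (Gfin0_ystar _ _ hN hA) sqrtrV// ler0n.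
have G00 y : -1 < y -> 0 < Gfin (A 0%N) y.
  by move=> ?; apply: Gfin_gt0 => //; apply: (admissible_cell _ _ hN hA); exact: ltnW.
have gap_lt y : -1 < y -> y != ystar -> gap y < N%:R.
  move=> yN1 ne; rewrite gtr_pMr ?ltr0n ?(ltnW hN)// ltrBlDr ltrDl divr_gt0//.
  rewrite exprn_even_gt0//= subr_eq0 -sG0.
  apply: contraNneq ne => /(congr1 (fun t => t ^+ 2)).
  rewrite !sqr_sqrtr ?ltW ?G00// (Gfin0_ystar _ _ hN hA).
  by move=> /(Gfin0_inj _ _ hN hA) ->.
have Glt y y' : -1 < y -> y < y' ->
    Num.sqrt (Gfin (A 0%N) y) < Num.sqrt (Gfin (A 0%N) y').
  move=> yN1 yy'; rewrite ltr_sqrt; last by apply: G00; exact: lt_trans yy'.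
  exact: (Gfin0_lt _ _ hN hA).
(* The three terms serve [y] within [e] of [ystar], [y] to its right and [y] to its left. *)
pose rho := Num.max ((root2 ystar + N%:R) / 2) (Num.max (gap (ystar + e)) (gap (ystar - e))).
exists rho.
  rewrite !gt_max (midf_lt lt0).2 !gap_lt//; try lra.
move=> y yN1; rewrite !le_max.
have [h1|h1] := leP (ystar + e) y.
  apply/orP; right; apply/orP; left.
  apply: le_trans (root2_le_gap y 0 (ltnW hN) yN1) _.
  rewrite ler_wpM2l ?ler0n// lerB// ler_wpM2r ?invr_ge0//.
  have l1 : r^-1 < Num.sqrt (Gfin (A 0%N) (ystar + e)) by rewrite -sG0; apply: Glt; lra.
  have l2 : Num.sqrt (Gfin (A 0%N) (ystar + e)) <= Num.sqrt (Gfin (A 0%N) y).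
    by move: h1; rewrite le_eqVlt => /predU1P[->//|/Glt h]; apply/ltW/h; lra.
  by rewrite lerXn2r ?nnegrE; lra.
have [h2|h2] := leP y (ystar - e).
  apply/orP; right; apply/orP; right.
  apply: le_trans (root2_le_gap y 0 (ltnW hN) yN1) _.
  rewrite ler_wpM2l ?ler0n// lerB// ler_wpM2r ?invr_ge0//.
  have l1 : Num.sqrt (Gfin (A 0%N) (ystar - e)) < r^-1 by rewrite -sG0; apply: Glt; lra.
  have l2 : Num.sqrt (Gfin (A 0%N) y) <= Num.sqrt (Gfin (A 0%N) (ystar - e)).
    by move: h2; rewrite le_eqVlt => /predU1P[->//|/Glt h]; apply/ltW/h; lra.
  (* Both differences are negative here, so signs are flipped before squares are compared. *)
  rewrite -[leLHS]sqrrN -[leRHS]sqrrN.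
  by rewrite lerXn2r ?nnegrE; lra.
apply/orP; left; apply/ltW/hd; rewrite /ball /= ltr_norml.
by apply/andP; split; lra.
Qed.

End Contraction.

(** * Exponential bound on the root sums of even level *)

Section RootSumBound.
Context {R : realType} (N : nat) (A : nat -> 'M[R]_2) (phi : R -> R).
Hypotheses (hN : (2 <= N)%N) (hA : admissible N A) (hphi : is_solution N A phi).

(** Two uses of [root_sum_rec] peel off the weights of [root2]; the remaining sums are based at
    points that are again above [-1], where the induction hypothesis holds. *)
Lemma root_sum_le (rho : R) : 
  (forall y : R, -1 < y -> root2 N A y <= rho) ->
  forall n y, -1 < y -> root_sum N phi y n.*2 <= rho ^+ n.
Proof.
move=> hrho; elim=> [|n IH] y y1.
  rewrite /root_sum double0 expn0 big_nat1 expr0 /grid_mass expr0 !divr1.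
  have p1 : 0 <= phi 1 <= 1 by apply: (sol_range hphi); lra.
  have p0 : 0 <= phi 0 <= 1 by apply: (sol_range hphi); lra.
  have := mob_le1 y1 p1; have := mob_ge0 y _ y1 p0 => h0 h1.
  by rewrite -[leRHS]sqrtr1; apply: ler_wsqrtr; lra.
have step k : (k < N)%N -> -1 < Hfin (A k) y.
  by move=> kN; apply: (Hfin_gt _ _ hN hA).
rewrite doubleS (root_sum_rec _ _ _ hN hA hphi)//.
rewrite exprS; apply: le_trans (_ : root2 N A y * rho ^+ n <= _); last first.
  apply: ler_wpM2r; last exact: hrho.
  apply: exprn_ge0; apply: le_trans (hrho _ y1).
  apply: sumr_ge0 => k _; apply: mulr_ge0; first exact: sqrtr_ge0.
  exact: root1_ge0.
rewrite mulr_suml; apply: ler_sum => k _; rewrite -mulrA.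
apply: ler_wpM2l; first exact: sqrtr_ge0.
rewrite (root_sum_rec _ _ _ hN hA hphi); last exact: step.
rewrite mulr_suml; apply: ler_sum => l _.
apply: ler_wpM2l; first exact: sqrtr_ge0.
by apply: IH; apply: (Hfin_gt _ _ hN hA) => //; exact: step.
Qed.

End RootSumBound.

(** * Hausdorff measure and doubly indexed covers *)

Section Hausdorff.
Context {R : realType}.
Implicit Types (s : R) (B : set R).

Lemma hgauge_ge0 s (U : set R) : (0 <= hgauge s U)%E.
Proof. by rewrite /hgauge; case: ifP => // _; exact: poweR_ge0. Qed.

Lemma hgauge_set0 s : hgauge s (set0 : set R) = 0%E.
Proof. by rewrite /hgauge asboolT. Qed.

Lemma diam_le (U : set R) (d : R) :
  (forall x y, U x -> U y -> `|x - y| <= d) -> (diam U <= d%:E)%E.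
Proof.
move=> h; apply: ge_ereal_sup => _ [[x y] [/= Ux Uy] <-].
by rewrite lee_fin; exact: h.
Qed.

Lemma hgauge_le s (U : set R) (d : R) : 0 <= s -> 0 <= d -> (diam U <= d%:E)%E ->
  (hgauge s U <= (d `^ s)%:E)%E.
Proof.
move=> s0 d0 Ud; rewrite /hgauge; case: asboolP => [_|/eqP/set0P[x Ux]].
  by rewrite lee_fin powR_ge0.
(* Monotonicity needs a nonnegative diameter; the point [x] of [U] supplies the distance [0]. *)
rewrite -poweR_EFin; apply: gt0_ler_poweR => //.
  rewrite in_itv /= leey andbT.
  by apply: ereal_sup_ubound; exists (x, x) => //=; rewrite subrr normr0.
by rewrite in_itv /= leey andbT lee_fin.
Qed.

Lemma hausdorff_pre_ge0 s (delta : R) B : (0 <= hausdorff_pre s delta B)%E.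
Proof.
apply: le_ereal_inf_tmp => _ [U _ <-].
by apply: nneseries_ge0 => k _ _; exact: hgauge_ge0.
Qed.

(** A bijection from [nat] to [nat * nat] makes the family a sequence; the terms are nonnegative, so
    the sum can be rearranged. *)
Lemma hausdorff_pre_le s (delta : R) B (U : nat -> nat -> set R) :
  (forall n j, diam (U n j) <= delta%:E)%E ->
  B `<=` \bigcup_n \bigcup_j U n j ->
  (hausdorff_pre s delta B <= \sum_(n <oo) \sum_(j <oo) hgauge s (U n j))%E.
Proof.
move=> Ud BU.
have /card_esym/ppcard_eqP[f] := card_nat2.
pose V k := U (f k).1 (f k).2.
apply: (@le_trans _ _ (\sum_(k <oo) hgauge s (V k))%E).
  apply: ereal_inf_lbound; exists V => //; split=> [k|x /BU [n _ [j _ Ux]]].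
    exact: Ud.
  by exists (f^-1%FUN (n, j)) => //; rewrite /V invK ?inE.
rewrite nneseries_esumT; last by move=> *; exact: hgauge_ge0.
have -> : (\sum_(n <oo) \sum_(j <oo) hgauge s (U n j) =
    \esum_(n in setT) \esum_(j in setT) hgauge s (U n j))%E.
  rewrite nneseries_esumT; last first.
    by move=> n; apply: nneseries_ge0 => *; exact: hgauge_ge0.
  apply: eq_esum => n _; rewrite nneseries_esumT// => j; exact: hgauge_ge0.
rewrite esum_esum; last by move=> *; exact: hgauge_ge0.
have -> : setT `*`` (fun=> setT) = [set: nat * nat].
  by apply/seteqP; split.
by rewrite (reindex_esum setT setT f)//; exact: bij.
Qed.

(* The Borel--Cantelli argument for Hausdorff measure: each tail of the
   double sequence covers [B]. *)
Lemma hausdorff_measure_eq0 s B (U : nat -> nat -> set R) (d : R ^nat) :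
  (\sum_(n <oo) \sum_(j <oo) hgauge s (U n j) < +oo)%E ->
  (forall n j, diam (U n j) <= (d n)%:E)%E -> d @ \oo --> 0 ->
  B `<=` lim_sup_set (fun n => \bigcup_j U n j) ->
  hausdorff_measure s B = 0%E.
Proof.
move=> sumU Ud d0 BU; apply/eqP; rewrite eq_le; apply/andP; split; last first.
  apply: le_trans (hausdorff_pre_ge0 s 1 B) _.
  by apply: ereal_sup_ubound; exists 1 => //=; exact: ltr01.
apply: ge_ereal_sup => _ [delta /= delta0 <-].
have tail0 := nneseries_tail_cvg sumU (fun n _ => nneseries_ge0 (fun j _ _ => hgauge_ge0 s (U n j))).
apply: (cvge_to_ge tail0).
have /(cvgr_lt 0)/(_ _ delta0) [L _ dL] := d0.
exists L => // M /= LM.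
(* Levels below [M] are replaced by empty sets, which have gauge [0], so the double sum becomes the
   tail from [M]. *)
pose V n := if (M <= n)%N then U n else fun=> set0.
apply: le_trans (_ : \sum_(n <oo) \sum_(j <oo) hgauge s (V n j) <= _)%E.
  apply: hausdorff_pre_le => [n j|x Bx].
    rewrite /V; case: ifPn => Mn.
      apply: le_trans (Ud n j) _; rewrite lee_fin ltW//.
      by apply: dL; exact: leq_trans Mn.
    by apply: diam_le.
  have [n /= Mn Ux] := BU x Bx M I; exists n => //.
  by rewrite /V Mn.
rewrite [leRHS]eseries_cond [leRHS]eseries_mkcond; apply: lee_nneseries => n.
  by move=> _ _; apply: nneseries_ge0 => *; exact: hgauge_ge0.
move=> _; rewrite /V /=; case: ifP => // _.
by rewrite eseries0// => j _ _; exact: hgauge_set0.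
Qed.

End Hausdorff.

(** * From root sums to a dimension below [1] *)

Section DimensionBound.
Context {R : realType}.

Lemma geometric_eseries_lty (tau : R) : 0 <= tau < 1 ->
  (\sum_(n <oo) (tau ^+ n)%:E < +oo)%E.
Proof.
move=> /andP[t0 t1].
apply: (@le_lt_trans _ _ (1 - tau)^-1%:E); last exact: ltry.
apply: lime_le.
  by apply: is_cvg_nneseries => n _ _; rewrite lee_fin exprn_ge0.
near=> n; rewrite sumEFin lee_fin.
have -> : \sum_(0 <= i < n) tau ^+ i = (1 - tau ^+ n) / (1 - tau).
  apply: (@mulIf _ (1 - tau)); first by rewrite subr_eq0 gt_eqF.
  rewrite divfK; last by rewrite subr_eq0 gt_eqF.
  by rewrite big_mkord -[1 - tau ^+ n]opprB subrX1 mulrC -mulNr opprB.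
rewrite ler_piMl ?invr_ge0 ?subr_ge0 ?(ltW t1)//.
by rewrite gerBl exprn_ge0.
Unshelve. all: by end_near. Qed.

Lemma exists_nat_ceil (k : nat) (t : R) : 0 < t <= k%:R ->
  exists2 j, (j < k)%N & j%:R < t <= j.+1%:R.
Proof.
elim: k => [|k IH] /andP[t0 tk]; first by lra.
have [tk'|tk'] := leP t k%:R; last by exists k => //; rewrite tk' tk.
have [|j jk h] := IH; first by rewrite t0.
by exists j => //; rewrite ltnW.
Qed.

(** Left-open, so that a cell's mass is a difference of values of the distribution function and the
    cells of one level partition []0, 1]]. *)
Definition badic (b n j : nat) : set (measurableTypeR R) :=
  `]j%:R / b%:R ^+ n, j.+1%:R / b%:R ^+ n]%classic.

Lemma measurable_badic b n j : measurable (badic b n j).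
Proof. exact: measurable_itv. Qed.

(* At level [n] call a cell good if its mass is at least
   [(sqrt b * tau) ^- (2 * n)]. The hypothesis bounds the mass of the bad cells
   by [tau ^+ n] and the number of good cells by [(b * tau ^+ 3) ^+ n], and
   [s] is chosen so that [b ^- s = (b * tau ^+ 2) ^-1]. *)
Lemma measure_dim_lt1 (mu : probability (measurableTypeR R) R) (b : nat)
    (tau : R) : (1 < b)%N -> 0 < tau < 1 -> 1 <= b%:R * tau ^+ 2 ->
  mu `]0, 1]%classic = 1%E ->
  (forall n, \sum_(0 <= j < b ^ n) Num.sqrt (fine (mu (badic b n j))) <=
    (Num.sqrt b%:R * tau ^+ 2) ^+ n) ->
  (measure_dim mu < 1)%E.
Proof.
move=> b1 /andP[t0 t1] bt mu01 hsum.
have b0 : 0 < b%:R :> R by rewrite ltr0n ltnW.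
have sb0 : 0 < Num.sqrt b%:R :> R by rewrite sqrtr_gt0.
have sb2 : Num.sqrt b%:R ^+ 2 = b%:R :> R by rewrite sqr_sqrtr// ltW.
pose theta := (Num.sqrt b%:R * tau)^-1.
have th0 : 0 < theta by rewrite invr_gt0 mulr_gt0.
pose m n j := fine (mu (badic b n j)).
have m0 n j : 0 <= m n j by apply: fine_ge0.
have muE n j : mu (badic b n j) = (m n j)%:E.
  by rewrite fineK// fin_num_measure//; exact: measurable_badic.
pose good n j := theta ^+ n <= Num.sqrt (m n j).
pose bad n j : set (measurableTypeR R) :=
  if good n j then set0 else badic b n j.
have mbad n j : measurable (bad n j).
  by rewrite /bad; case: ifP => _ //; exact: measurable_badic.
pose Bad n := \big[setU/set0]_(j < b ^ n) bad n j.
have mBad n : measurable (Bad n) by exact: bigsetU_measurable.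
(* On a bad cell one factor [sqrt m] of the mass is below [theta ^+ n]. *)
have muBad n : (mu (Bad n) <= (tau ^+ n)%:E)%E.
  apply: (le_trans (le_mu_bigsetU mu (fun j _ => mbad n j))).
  apply: (@le_trans _ _ (theta ^+ n * \sum_(0 <= j < b ^ n) Num.sqrt (m n j))%:E).
    rewrite mulr_sumr big_mkord -sumEFin; apply: lee_sum => j _.
    rewrite /bad; case: ifPn => [_|].
      by rewrite measure0 lee_fin mulr_ge0 ?sqrtr_ge0 ?exprn_ge0 ?(ltW th0).
    rewrite -ltNge => /ltW small; rewrite [leLHS]muE lee_fin.
    by rewrite -{1}[m n j]sqr_sqrtr// expr2 ler_wpM2r ?sqrtr_ge0.
  rewrite lee_fin; apply: (@le_trans _ _ (theta ^+ n * (Num.sqrt b%:R * tau ^+ 2) ^+ n)).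
    by rewrite ler_wpM2l ?exprn_ge0 ?(ltW th0)//; exact: hsum.
  rewrite -exprMn /theta.
  suff -> : (Num.sqrt b%:R * tau)^-1 * (Num.sqrt b%:R * tau ^+ 2) = tau by [].
  by field; rewrite !gt_eqF.
have sumtau : (\sum_(n <oo) (tau ^+ n)%:E < +oo)%E.
  by apply: geometric_eseries_lty; rewrite ltW.
have limBad : mu (lim_sup_set Bad) = 0%E.
  apply: lim_sup_set_cvg0 => //; apply: le_lt_trans sumtau.
  by apply: lee_nneseries => [n _ _|n _]; [exact: measure_ge0|exact: muBad].
have mlim : measurable (lim_sup_set Bad).
  by apply: bigcapT_measurable => n; apply: bigcup_measurable.
pose B : set (measurableTypeR R) := `]0, 1]%classic `\` lim_sup_set Bad.
have m01 : measurable (`]0, 1]%classic : set (measurableTypeR R)).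
  exact: measurable_itv.
have muB : mu B = 1%E.
  rewrite measureD//; last by rewrite [X in (X < _)%E]mu01 ltry.
  rewrite -[RHS]sube0; congr (_ - _)%E; first exact: mu01.
  by apply: subset_measure0 limBad => //; exact: measurableI.
pose q := (b%:R * tau ^+ 2)^-1.
have q0 : 0 < q by rewrite invr_gt0 mulr_gt0// exprn_gt0.
have q1 : q <= 1 by rewrite invf_le1// mulr_gt0// exprn_gt0.
(* This strict inequality, that is [tau ^+ 2 < 1], is what makes [s < 1]. *)
have bq : b%:R^-1 < q.
  by rewrite ltf_pV2 ?posrE ?mulr_gt0 ?exprn_gt0// gtr_pMr// exprn_ilt1 ?ltW.
have lnb : ln (b%:R^-1) < 0 :> R.
  by rewrite lnV ?posrE// oppr_lt0 ln_gt0// ltr1n.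
pose s := ln q / ln (b%:R^-1).
have s0 : 0 <= s by apply: mulr_le0; [exact: ln_le0|rewrite invr_le0 ltW].
have s1 : s < 1 by rewrite ltr_ndivrMr// mul1r ltr_ln ?posrE//; rewrite invr_gt0.
have bs n : (b%:R ^- n) `^ s = q ^+ n.
  rewrite -exprVn -powR_mulrn ?invr_ge0 ?ltW// powRAC powR_mulrn ?powR_ge0//.
  congr (_ ^+ n); rewrite /powR gt_eqF ?invr_gt0// /s divfK ?lt_eqF//.
  by rewrite lnK.
pose U n j := if (j < b ^ n)%N && good n j then badic b n j else set0.
have diamU n j : (diam (U n j) <= (b%:R ^- n)%:E)%E.
  apply: diam_le => x y; rewrite /U; case: ifP => // _.
  rewrite /badic /= !in_itv /= mulrS mulrDl mul1r => /andP[x1 x2] /andP[y1 y2].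
  by rewrite ler_norml; apply/andP; split; lra.
have bn0 n : 0 < b%:R ^+ n :> R by rewrite exprn_gt0.
(* On a good cell [1 <= theta ^- n * sqrt m], so counting good cells reduces to the root sum. *)
have sumU n : (\sum_(j <oo) hgauge s (U n j) <= (tau ^+ n)%:E)%E.
  rewrite (nneseries_split 0 (b ^ n)); last by move=> *; exact: hgauge_ge0.
  rewrite add0n [X in (_ + X)%E]eseries0 ?adde0; last first.
    by move=> j bj _; rewrite /U ltnNge bj hgauge_set0.
  apply: (@le_trans _ _ ((q / theta) ^+ n * \sum_(0 <= j < b ^ n) Num.sqrt (m n j))%:E).
    rewrite mulr_sumr !big_mkord -sumEFin; apply: lee_sum => j _.
    have pos : 0 <= (q / theta) ^+ n * Num.sqrt (m n j).
      by rewrite mulr_ge0 ?sqrtr_ge0// exprn_ge0// divr_ge0 ?ltW.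
    have [gj|ngj] := boolP (good n j); last first.
      by rewrite /U (negbTE ngj) andbF hgauge_set0 lee_fin.
    apply: le_trans (hgauge_le _ _ _ s0 _ (diamU n j)) _; first by rewrite invr_ge0 ltW.
    rewrite bs lee_fin expr_div_n -mulrA ler_peMr ?exprn_ge0 ?(ltW q0)//.
    by rewrite mulrC ler_pdivlMr ?exprn_gt0// mul1r.
  rewrite lee_fin; apply: (@le_trans _ _ ((q / theta) ^+ n * (Num.sqrt b%:R * tau ^+ 2) ^+ n)).
    by apply: ler_wpM2l; [rewrite exprn_ge0// divr_ge0 ?ltW|exact: hsum].
  suff e : q / theta * (Num.sqrt b%:R * tau ^+ 2) = tau by rewrite -exprMn e.
  rewrite /q /theta -{1}sb2.
  by field; rewrite !gt_eqF.
have HB : hausdorff_measure s B = 0%E.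
  apply: (hausdorff_measure_eq0 _ _ U (fun n => b%:R ^- n)) => //.
  - apply: le_lt_trans sumtau; apply: lee_nneseries => n.
      by move=> _ _; apply: nneseries_ge0 => *; exact: hgauge_ge0.
    by move=> _; exact: sumU.
  - under eq_fun do rewrite -exprVn.
    by apply: cvg_expr; rewrite ger0_norm ?invr_ge0 ?ltW// invf_lt1// ltr1n.
  move=> x [x01 nlim] L _.
  (* Outside the limit superior, [x] avoids all bad cells from some level on, so its own cell at
     such a level is good. *)
  have [M nM] : exists M, forall n, (M <= n)%N -> ~ Bad n x.
    apply: contrapT => nex; apply: nlim => M _; apply: contrapT => nM.
    by apply: nex; exists M => n Mn Bx; apply: nM; exists n.
  exists (maxn L M); first by rewrite /= leq_maxl.
  set n := maxn L M.
  have nB := nM n (leq_maxr _ _).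
  have xb : 0 < x * b%:R ^+ n <= (b ^ n)%:R.
    move: x01; rewrite /= in_itv /= => /andP[x0 x1].
    by rewrite mulr_gt0//= natrX ler_piMl ?(ltW (bn0 n)).
  have [j jb xj] := exists_nat_ceil _ _ xb.
  have xbad : badic b n j x.
    by rewrite /badic /= in_itv /= ltr_pdivrMr// ler_pdivlMr.
  exists j => //; rewrite /U jb /=; case: ifPn => // ngj.
  apply: nB; rewrite /Bad -bigcup_mkord; exists j => //=.
by rewrite /bad (negbTE ngj).
have dimB : (hausdorff_dim B <= s%:E)%E.
  by apply: ereal_inf_lbound; exists s.
apply: le_lt_trans (_ : (_ <= s%:E)%E) _; last by rewrite lte_fin.
apply: le_trans dimB; apply: ereal_inf_lbound; exists B => //; split=> //.
  exact: measurableD.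
by move=> x [+ _]; rewrite /= !in_itv /= => /andP[/ltW -> ->].
Qed.

End DimensionBound.

(** * Conditions (a) and (b) expressed at [ystar] *)

Section Conditions.
Context {R : realType} (N : nat) (A : nat -> 'M[R]_2).
Hypotheses (hN : (2 <= N)%N) (hA : admissible N A).

Local Notation ystar := (ystar N A).

Lemma G_EFin k (y : R) : -1 < y -> G N A k y%:E = Gfin (A k) y.
Proof. by move=> y1; rewrite /G (gt_eqF y1) andbF. Qed.

Lemma bigcapG_ystar (y : \bar R) : bigcapG N A y -> y = ystar%:E.
Proof.
move=> /(_ 0%N (ltnW hN)) [_].
have n1 : N%:R != 1 :> R by rewrite pnatr_eq1 gtn_eqF.
have nz : N%:R != 0 :> R by rewrite pnatr_eq0 gtn_eqF// ltnW.
case: y => [r||] /=.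
(* As [N >= 2], index [0] is not the last one, so the special value at [-1] does not concern
   [G_0]. *)
- rewrite eq_sym -subn1 subn_eq0 leqNgt hN /= => /(Gfin0_inj _ _ hN hA) ->.
  by [].
- by move=> /esym/eqP; rewrite invr_eq1 (negbTE n1).
- by move=> /esym/eqP; rewrite invr_eq0 (negbTE nz).
Qed.

Lemma Hfin0_fixed (y : R) : Hfin (A 0%N) y = y ->
  mxa (A 0%N) != 1 /\ y = mxc (A 0%N) / (1 - mxa (A 0%N)).
Proof.
rewrite /Hfin (admissible_b0 _ _ hN hA) mul0r add0r divr1 => e.
have a1 : mxa (A 0%N) != 1.
  apply/eqP => a1; have := admissible_a0_lt _ _ hN hA.
  by move: e; rewrite a1; lra.
split=> //; apply: (@mulIf _ (1 - mxa (A 0%N))).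
  by rewrite subr_eq0 eq_sym.
by rewrite divfK ?subr_eq0 1?eq_sym//; lra.
Qed.

(** The fixed point of [H_0] is itself one of the terms in the minimum and maximum that bound [Y].
    This puts [ystar] in [Y] in the converse half of [conditionsP]. *)
Lemma Hfin0_fixed_Y (y : R) : Hfin (A 0%N) y = y -> Y N A y%:E.
Proof.
move=> /Hfin0_fixed[a1 ->]; pose i0 := Ordinal (ltnW hN).
rewrite /Y /=; apply/andP; split.
  rewrite lee_fin /Yalpha (bigminD1 i0)//= (negbTE a1).
  by rewrite ge_min lexx.
rewrite /Ybeta (bigmaxD1 i0)//= (negbTE a1).
by rewrite le_max lexx.
Qed.

Lemma conditionsP : condition_a N A /\ condition_b N A <->
  forall k, (k < N)%N -> Gfin (A k) ystar = N%:R^-1 /\ Hfin (A k) ystar = ystar.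
Proof.
have y1 := ystar_gtN1 _ _ hN hA.
split=> [[[y yG] hb] k kN|h].
  have e := bigcapG_ystar _ yG; rewrite {}e in yG.
  split; first by have [_ ?] := yG k kN; rewrite -G_EFin.
  by have [_ []] := hb _ yG k kN.
have Yy : Y N A ystar%:E by apply: Hfin0_fixed_Y; have [] := h _ (ltnW hN).
split.
  by exists ystar%:E => k kN; split=> //; rewrite /mkset G_EFin//; have [] := h k kN.
move=> y /bigcapG_ystar -> k kN; split=> //=.
by have [_ e] := h k kN; congr EFin.
Qed.

End Conditions.

(** * The dimension bound applied to the measure with distribution function [phi] *)

Section Distribution.
Context {R : realType} (N : nat) (A : nat -> 'M[R]_2) (phi : R -> R)
  (mu : probability (measurableTypeR R) R).
Hypotheses (hN : (2 <= N)%N) (hA : admissible N A)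
  (hphi : is_solution N A phi) (hmu : is_distribution_function mu phi).

(** [phi 0] is the mass of the point [0], and the functional equation shows that it vanishes:
    [phi 0] is a fixed point of [Phi (A 0%N)], and [a_0 <= 1] with [a_0 < c_0 + 1] excludes a
    nonzero one in [[0, 1]]. *)
Lemma phi_0 : phi 0 = 0.
Proof.
have n0 : 0 < N%:R :> R by rewrite ltr0n ltnW.
have p0 : 0 <= phi 0 <= 1 by apply: (sol_range hphi); lra.
have := @sol_eq _ _ _ _ hphi 0%N 0 (ltnW hN).
rewrite mul0r lexx divr_ge0 ?ler0n// mulr0 subr0 => /(_ isT).
have cM := admissible_cell _ _ hN hA (ltnW hN).
have d := cell_den cM p0.
have ac := admissible_a0_lt _ _ hN hA.
rewrite /Phi (cell_d _ cM) (admissible_b0 _ _ hN hA) addr0.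
move=> /(congr1 (fun t => t * (mxc (A 0%N) * phi 0 + 1))).
rewrite divfK ?gt_eqF// => e.
have : phi 0 * (mxc (A 0%N) * phi 0 + 1 - mxa (A 0%N)) = 0 by lra.
move=> /eqP; rewrite mulf_eq0 => /orP[/eqP//|/eqP e'].
have a0 := admissible_a0_gt0 _ _ hN hA.
have a1 : mxa (A 0%N) <= 1.
  have := adm_contr hA (ltnW hN); rewrite le_min => /andP[+ _].
  rewrite (cell_d _ cM) (admissible_b0 _ _ hN hA) mulr1 mul0r subr0.
  by rewrite -[leRHS]sqrtr1 ler_sqrt ?ltr01.
case/andP: p0 => p0 p1.
have [c0|c0] := ltP (mxc (A 0%N)) 0; first by nra.
have : mxc (A 0%N) * phi 0 = 0 by nra.
move=> /eqP; rewrite mulf_eq0 => /orP[/eqP c00|/eqP//].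
by move: e' ac; rewrite c00; lra.
Qed.

Lemma phi_1 : phi 1 = 1.
Proof.
case: hmu => m1 /(_ 1); rewrite ler01 lexx => /(_ isT).
by rewrite m1 => -[].
Qed.

Lemma mu_itv (x y : R) : 0 <= x -> x <= y -> y <= 1 ->
  mu `]x, y]%classic = (phi y - phi x)%:E.
Proof.
move=> x0 xy y1; case: hmu => _ hF.
have mI (t : R) : measurable (`[0, t]%classic : set (measurableTypeR R)).
  exact: measurable_itv.
have -> : `]x, y]%classic = `[0, y] `\` `[0, x] :> set R.
  apply/seteqP; split => t /=; rewrite !in_itv /=.
    move=> /andP[xt ty]; split; first by rewrite ty andbT; lra.
    by apply/negP; rewrite negb_and -[~~ (t <= x)]ltNge xt orbT.
  move=> [/andP[t0 ty]] /negP; rewrite t0 /= -ltNge => xt.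
  by rewrite xt ty.
rewrite measureD//; last first.
  by apply: le_lt_trans (probability_le1 mu (mI y)) _; exact: ltry.
have -> : `[0, y]%classic `&` `[0, x]%classic = `[0, x]%classic :> set R.
  apply/seteqP; split => t /=; rewrite !in_itv /=; first by case.
  by move=> /andP[t0 tx]; rewrite t0 tx (le_trans tx xy).
rewrite EFinB; congr (_ - _)%E; apply: hF; lra.
Qed.

Lemma measure_dim_lt1_of_rho (rho : R) : rho < N%:R ->
  (forall y : R, -1 < y -> root2 N A y <= rho) -> (measure_dim mu < 1)%E.
Proof.
move=> rhoN hrho.
have n0 : 0 < N%:R :> R by rewrite ltr0n ltnW.
have n2 : 2 <= N%:R :> R by rewrite ler_nat.
have sN : Num.sqrt (N ^ 2)%:R = N%:R :> R by rewrite natrX sqrtr_sqr ger0_norm ?ler0n.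
have rho0 : 0 <= rho.
  have h : -1 < 0 :> R by lra.
  apply: le_trans (hrho 0 h); apply: sumr_ge0 => k _.
  by apply: mulr_ge0; [exact: sqrtr_ge0|exact: root1_ge0].
(* The second term gives [rho <= N * tau ^+ 2]; the first gives [N * tau >= 1]. *)
pose tau := Num.max 2^-1 (Num.sqrt (rho / N%:R)).
have rt : rho <= N%:R * tau ^+ 2.
  rewrite mulrC -ler_pdivrMr// -[leLHS]sqr_sqrtr ?divr_ge0 ?ler0n//.
  by rewrite lerXn2r ?nnegrE ?sqrtr_ge0// /tau ?le_max ?sqrtr_ge0 ?lexx ?orbT.
have t2 : 2^-1 <= tau by rewrite le_max lexx.
have t1 : tau < 1.
  rewrite gt_max; apply/andP; split; first by lra.
  by rewrite -[ltRHS]sqrtr1 ltr_sqrt// ltr_pdivrMr// mul1r.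
(* Base [N ^ 2], because [root_sum_le] bounds the even levels. *)
apply: (measure_dim_lt1 mu (N ^ 2) tau).
- by rewrite -[1%N](exp1n 2) ltn_exp2r.
- by apply/andP; split; lra.
- rewrite natrX -exprMn exprn_ege1//.
  by apply: le_trans (_ : 2 * 2^-1 <= _); [lra|apply: ler_pM; lra].
- by rewrite mu_itv ?lexx ?ler01// phi_0 phi_1 subr0.
move=> n; rewrite sN.
have N10 : -1 < 0 :> R by lra.
apply: le_trans (_ : rho ^+ n <= _); last first.
  by apply: lerXn2r; rewrite ?nnegrE// (le_trans rho0 rt).
(* At [y = 0] the map [mob y] is the identity, so [grid_mass] is the mass under [mu]. *)
apply: le_trans (root_sum_le _ _ _ hN hA hphi _ hrho n 0 N10).
rewrite /root_sum -expnM mul2n.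
rewrite le_eqVlt; apply/orP; left; apply/eqP.
apply: eq_big_nat => j /andP[_ jN]; congr Num.sqrt.
have e : (N ^ 2)%:R ^+ n = N%:R ^+ n.*2 :> R by rewrite natrX -exprM mul2n.
rewrite /badic e /grid_mass !mob0.
have /andP[j0 _] := grid_01 N hN (ltnW jN) : 0 <= (j%:R / N%:R ^+ n.*2 : R) <= 1.
have /andP[_ j1] := grid_01 N hN jN : 0 <= (j.+1%:R / N%:R ^+ n.*2 : R) <= 1.
rewrite mu_itv//.
by rewrite ler_pM2r ?ler_nat// invr_gt0 exprn_gt0.
Qed.

End Distribution.

(** * Dimension drop or explicit distribution function *)

Theorem theorem3p20 (R : realType) (N : nat) (A : nat -> 'M[R]_2)
    (phi : R -> R) (mu : probability (measurableTypeR R) R)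
    (hN : (2 <= N)%N) (hA : admissible N A) (hphi : is_solution N A phi)
    (hmu : is_distribution_function mu phi) :
  (~ condition_a N A \/ ~ condition_b N A -> (measure_dim mu < 1)%E) /\
  (condition_a N A /\ condition_b N A ->
    forall x : R, 0 <= x <= 1 ->
      phi x = ((N%:R - 1) * x)
              / (N%:R - 1 - mxc (A 0%N) * N%:R * (x - 1))).
Proof.
split=> [nab|/(conditionsP _ _ hN hA) h x x01].
  have [rho rhoN hrho] : exists2 rho, rho < N%:R & forall y : R, -1 < y -> root2 N A y <= rho.
    apply: (root2_unif _ _ hN hA) => /(conditionsP _ _ hN hA)[ha hb].
    by case: nab.
  exact: (measure_dim_lt1_of_rho _ _ _ _ hN hA hphi hmu rho).
have y1 := ystar_gtN1 _ _ hN hA.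
have n1 : 1 < N%:R :> R by rewrite ltr1n.
have := mob_phi_eq_id _ _ _ hN hA hphi _ y1 (fun k kN => (h k kN).1)
  (fun k kN => (h k kN).2) x x01.
have [hG hH] := h _ (ltnW hN).
have p01 := sol_range hphi x01.
have d := mob_den_gt0 y1 p01.
move: (ystar N A) y1 hG hH d => y y1 hG hH d.
(* The equations [H_0 y = y] and [G_0 y = 1 / N] determine [a_0] and express [c_0] through [y]. *)
have ey : mxa (A 0%N) * y + mxc (A 0%N) = y.
  by move: hH; rewrite /Hfin (admissible_b0 _ _ hN hA) mul0r add0r divr1.
have ea : mxa (A 0%N) = N%:R^-1.
  move: hG; rewrite (Gfin0 _ _ hN hA) ey -mulrA divff ?mulr1// gt_eqF//; lra.
have ec : mxc (A 0%N) = y * (N%:R - 1) / N%:R.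
  have -> : mxc (A 0%N) = y - mxa (A 0%N) * y by lra.
  by rewrite ea; field; rewrite gt_eqF//; lra.
(* Solving [mob y (phi x) = x] gives [phi x = x / (1 + y * (1 - x))]. *)
rewrite /mob => /(congr1 (fun t => t * (y * phi x + 1))).
rewrite divfK ?gt_eqF// => e.
have dx : 0 < 1 + y * (1 - x).
  have x'01 : 0 <= 1 - x <= 1 by lra.
  by have := mob_den_gt0 y1 x'01; lra.
have -> : N%:R - 1 - mxc (A 0%N) * N%:R * (x - 1) = (N%:R - 1) * (1 + y * (1 - x)).
  by rewrite ec divfK ?gt_eqF//; [ring|lra].
rewrite -mulf_div divff ?mul1r; last by rewrite gt_eqF//; lra.
by apply: (@mulIf _ (1 + y * (1 - x))); rewrite ?gt_eqF// divfK ?gt_eqF//; lra.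
Qed.
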